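(* Let $G$ be a group with the Magnus property, and let $N \trianglelefteq G$ be a normal subgroup such that for each $g \in G \smallsetminus N$ the set of normal subgroups \[ \Omega_{gN} = \big\{ \langle gz \rangle^G \mid z \in N \big\}, \] partially ordered by inclusion $\subseteq$, satisfies the minimal condition. Then $G/N$ has the Magnus property.
   Context: $\langle x\rangle^G$ denotes the normal closure of $x$ in $G$. A group $G$ has the Magnus property if, whenever $g,h \in G$ satisfy $\langle g\rangle^G = \langle h\rangle^G$, $g$ is conjugate in $G$ to $h$ or to $h^{-1}$. A partially ordered set satisfies the minimal condition if every non-empty subset has a minimal element. *)

(* Defs.v *)
From HB Require Import structures.
From mathcomp Require Import all_boot.
From mathcomp Require Import boolp classical_sets.

Set Implicit Arguments.
Unset Strict Implicit.
Unset Printing Implicit Defensive.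

Local Open Scope group_scope.
Local Open Scope classical_set_scope.
Local Open Scope quotient_scope.

Definition normal_subgroup (G : groupType) (N : set G) : Prop :=
  group_closed [in N] /\ forall x g : G, N x -> N (x ^ g).

Definition normal_closure (G : groupType) (x : G) : set G :=
  smallest (@normal_subgroup G) [set x].

Definition conjugate (G : groupType) (g h : G) : Prop :=
  exists x : G, g ^ x = h.

Definition magnus_property (G : groupType) : Prop :=
  forall g h : G, normal_closure g = normal_closure h ->
    conjugate g h \/ conjugate g h^-1.

Definition minimal_condition (T : Type) (le : T -> T -> Prop) (A : set T) :
    Prop :=
  forall S : set T, S `<=` A -> S !=set0 ->
    exists2 m, S m & forall x, S x -> le x m -> x = m.

Section Quotient.
Variables (G : groupType) (N : set G) (nN : normal_subgroup N).

Let N1 : N 1.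
Proof. by case: nN => -[+ _] _; rewrite inE. Qed.

Let NF x y : N x -> N y -> N (x / y).
Proof.
case: nN => -[_ NF _] Nx Ny.
by move: (NF x y); rewrite !inE; apply.
Qed.

Let NV x : N x -> N x^-1.
Proof. by move=> Nx; rewrite -[x^-1]mul1g; apply: NF. Qed.

Let NM x y : N x -> N y -> N (x * y).
Proof. by move=> Nx /NV Ny; rewrite -[y]invgK; apply: NF. Qed.

Let NJ x g : N x -> N (x ^ g).
Proof. by case: nN => _ +; apply. Qed.

(* x and y lie in the same coset: xN = yN. *)
Definition coset_eq (x y : G) : bool := `[< N (x^-1 * y) >].

Lemma coset_eq_refl : reflexive coset_eq.
Proof. by move=> x; apply/asboolP; rewrite mulVg. Qed.

Lemma coset_eq_sym : symmetric coset_eq.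
Proof.
move=> x y; apply: asbool_equiv_eq.
by split=> /NV; rewrite invgM invgK.
Qed.

Lemma coset_eq_trans : transitive coset_eq.
Proof.
move=> y x z /asboolP Nxy /asboolP Nyz; apply/asboolP.
by have := NM Nxy Nyz; rewrite mulgA mulgK.
Qed.

Definition coset_equiv := EquivRel coset_eq
  coset_eq_refl coset_eq_sym coset_eq_trans.

Definition quotient_group : Type := {eq_quot coset_equiv}.

HB.instance Definition _ := EqQuotient.on quotient_group.
HB.instance Definition _ := Choice.on quotient_group.

Definition quotient_mul := lift_op2 quotient_group (@mul G).
Definition quotient_one : quotient_group := \pi_quotient_group 1.
Definition quotient_inv := lift_op1 quotient_group (@inv G).

Lemma eq_piP (x y : G) :
  \pi_quotient_group x = \pi_quotient_group y <-> N (x^-1 * y).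
Proof.
split=> [/eqmodP/asboolP //|Nxy].
by apply/eqmodP/asboolP.
Qed.

Lemma quotient_mulE (x y : G) :
  quotient_mul (\pi_quotient_group x) (\pi_quotient_group y) =
    \pi_quotient_group (x * y).
Proof.
unlock quotient_mul; case: piP => x' /eq_piP Nx; case: piP => y' /eq_piP Ny.
apply/esym/eq_piP; have := NM (NJ y Nx) Ny.
by rewrite conjgE invgM -!mulgA mulVKg.
Qed.

Lemma quotient_invE (x : G) :
  quotient_inv (\pi_quotient_group x) = \pi_quotient_group x^-1.
Proof.
unlock quotient_inv; case: piP => x' /eq_piP Nx.
apply/eq_piP; rewrite invgK.
by have := NJ x^-1 Nx; rewrite conjgE invgK mulgA mulVKg.
Qed.

Lemma quotient_mulA : associative quotient_mul.
Proof.
move=> X Y Z; rewrite -[X]reprK -[Y]reprK -[Z]reprK.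
by rewrite !quotient_mulE mulgA.
Qed.

Lemma quotient_mul1 : left_id quotient_one quotient_mul.
Proof. by move=> X; rewrite -[X]reprK quotient_mulE mul1g. Qed.

Lemma quotient_mul1r : right_id quotient_one quotient_mul.
Proof. by move=> X; rewrite -[X]reprK quotient_mulE mulg1. Qed.

Lemma quotient_mulV : left_inverse quotient_one quotient_inv quotient_mul.
Proof. by move=> X; rewrite -[X]reprK quotient_invE quotient_mulE mulVg. Qed.

Lemma quotient_mulVr : right_inverse quotient_one quotient_inv quotient_mul.
Proof. by move=> X; rewrite -[X]reprK quotient_invE quotient_mulE mulgV. Qed.

HB.instance Definition _ := isGroup.Build quotient_group
  quotient_mulA quotient_mul1 quotient_mul1r quotient_mulV quotient_mulVr.

End Quotient.

Definition Omega (G : groupType) (N : set G) (g : G) : set (set G) :=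
  [set normal_closure (g * z) | z in N].

(* Main.v *)
Require Import Defs.
From HB Require Import structures.
From mathcomp Require Import all_boot.
From mathcomp Require Import boolp classical_sets.

(** The Magnus property speaks of single elements, whereas a coset only fixes
    an element up to a factor in N; minimality picks the right representative.
    Suppose that the cosets aN and bN have the same normal closure in G / N,
    with a outside N.  Changing a within its coset, let the normal closure of
    a be minimal in [Omega N a].  Since bN lies in the normal closure of aN,
    some representative bw of bN lies in the normal closure of a; conversely,
    aN lies in the normal closure of bwN, so some az lies in the normal
    closure of bw ([normal_closure_lift], used twice).  So the closures of az,
    bw and a form an ascending chain, its ends agree by minimality, and a and
    bw have the same normal closure.  The Magnus property of G makes a
    conjugate to bw or to its inverse, and this projects to G / N.  If a lies
    in N, then aN is trivial, hence so is bN. *)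

Set Implicit Arguments.
Unset Strict Implicit.
Unset Printing Implicit Defensive.

Local Open Scope group_scope.
Local Open Scope classical_set_scope.
Local Open Scope quotient_scope.

Section NormalClosure.
Variable G : groupType.
Implicit Types (x y : G) (H : set G).

Lemma normal_subgroupP H :
  normal_subgroup H <->
  [/\ H 1, forall x y, H x -> H y -> H (x / y)
    & forall x g, H x -> H (x ^ g)].
Proof.
split=> [[[+ HF] HJ]|[H1 HF HJ]].
  rewrite inE => H1; split=> // x y Hx Hy.
  by move: (HF x y); rewrite !inE; apply.
split=> //; split=> [|x y]; first by rewrite inE.
by rewrite !inE; apply: HF.
Qed.

Lemma normal_closure_id x : normal_closure x x.
Proof. by move=> H [_]; apply. Qed.

Lemma normal_closure_min H x :
  normal_subgroup H -> H x -> normal_closure x `<=` H.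
Proof. by move=> nH Hx y; apply; split=> // _ ->. Qed.

Lemma normal_closure_normal x : normal_subgroup (normal_closure x).
Proof.
apply/normal_subgroupP; split.
- by move=> H [/normal_subgroupP[]].
- move=> y z Ny Nz H nH; have [/normal_subgroupP[_ HF _] _] := nH.
  by apply: HF; [apply: Ny | apply: Nz].
- move=> y g Ny H nH; have [/normal_subgroupP[_ _ HJ] _] := nH.
  by apply: HJ; apply: Ny.
Qed.

Lemma normal_closure_sub x y :
  normal_closure y x -> normal_closure x `<=` normal_closure y.
Proof. by apply: normal_closure_min; apply: normal_closure_normal. Qed.

Lemma normal_closure1 : normal_closure (1 : G) = [set 1].
Proof.
apply/seteqP; split=> [|_ ->]; last exact: normal_closure_id.
apply: normal_closure_min => //; apply/normal_subgroupP; split=> //=.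
- by move=> x y -> ->; rewrite mulgV.
- by move=> x g ->; rewrite conj1g.
Qed.

End NormalClosure.

Section QuotientProjection.
Variables (G : groupType) (N : set G) (nN : normal_subgroup N).

Let p (x : G) : quotient_group nN := \pi x.

Lemma projM x y : p (x * y) = p x * p y.
Proof. by rewrite /p -quotient_mulE. Qed.

Lemma projV x : p x^-1 = (p x)^-1.
Proof. by rewrite /p -quotient_invE. Qed.

Lemma projJ x y : p (x ^ y) = p x ^ p y.
Proof. by rewrite !conjgE !projM projV. Qed.

Lemma proj_eq1 x : N x -> p x = 1.
Proof.
move=> Nx; have [N1 NF _] := (normal_subgroupP N).1 nN.
rewrite -[RHS]/(p 1); apply/Defs.eq_piP.
by rewrite mulg1 -[x^-1]mul1g; apply: NF.
Qed.

Lemma proj_mulr x z : N z -> p (x * z) = p x.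
Proof. by move=> Nz; rewrite projM (proj_eq1 Nz) mulg1. Qed.

Lemma proj_conjugate x y : conjugate x y -> conjugate (p x) (p y).
Proof. by case=> g <-; exists (p g); rewrite projJ. Qed.

Lemma proj_normal_subgroup (H : set G) :
  normal_subgroup H -> normal_subgroup (p @` H).
Proof.
move=> /normal_subgroupP[H1 HF HJ]; apply/normal_subgroupP; split.
- by exists 1 => //; apply: proj_eq1; case/normal_subgroupP: nN.
- move=> _ _ [x Hx <-] [y Hy <-]; exists (x / y); first exact: HF.
  by rewrite projM projV.
- move=> _ Y [x Hx <-]; exists (x ^ repr Y); first exact: HJ.
  by rewrite projJ /p reprK.
Qed.

(** The image in the quotient of the normal closure of x is normal and
    contains the coset of x, so every coset in the normal closure of that
    coset has a representative in the normal closure of x. *)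
Lemma normal_closure_lift x y :
  normal_closure (p x) (p y) -> exists2 w, N w & normal_closure x (y * w).
Proof.
move=> cxy; have [k cxk kE] : (p @` normal_closure x) (p y).
  apply: normal_closure_min cxy.
    by apply: proj_normal_subgroup; apply: normal_closure_normal.
  by exists x => //; apply: normal_closure_id.
exists (y^-1 * k); last by rewrite mulVKg.
by apply/Defs.eq_piP; rewrite -/(p y) -kE.
Qed.

(** Since a and az span the same coset, the minimal member of [Omega N a] is
    minimal in [Omega N (a * z)], where it is the closure of the chosen
    representative itself. *)
Lemma Omega_minimal_representative a :
  minimal_condition (@subset G) (Omega N a) ->
  exists2 z, N z & forall w, N w ->
    normal_closure (a * z * w) `<=` normal_closure (a * z) ->
    normal_closure (a * z * w) = normal_closure (a * z).
Proof.
have [N1 NF _] := (normal_subgroupP N).1 nN.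
have NM x y : N x -> N y -> N (x * y).
  move=> Nx Ny; rewrite -[y]invgK; apply: (NF) => //.
  by rewrite -[y^-1]mul1g; apply: NF.
case/(_ (Omega N a)) => //; first by exists (normal_closure (a * 1)); exists 1.
move=> _ [z Nz <-] minz; exists z => // w Nw; apply: minz.
by exists (z * w); rewrite ?mulgA //; apply: NM.
Qed.

End QuotientProjection.

Theorem proposition2p4 (G : groupType) (N : set G) (nN : normal_subgroup N) :
  magnus_property G ->
  (forall g : G, ~ N g -> minimal_condition (@subset G) (Omega N g)) ->
  magnus_property (quotient_group nN).
Proof.
move=> mG minN A B; rewrite -[A]reprK -[B]reprK.
move: (repr A) (repr B) => {A B} a b cab.
have [Na|/minN/(Omega_minimal_representative nN)] := pselect (N a).
  have a1 := proj_eq1 nN Na; left; exists 1; rewrite conjg1 a1.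
  have := @normal_closure_id _ (\pi_(quotient_group nN) b).
  by rewrite -cab a1 normal_closure1.
(* From here on, a stands for the minimal representative a * z. *)
case=> z Nz minz; move: cab.
rewrite -(proj_mulr nN a Nz); move: (a * z) minz => {Nz}a minz cab.
have [|w Nw caw] := @normal_closure_lift _ _ nN a b.
  by rewrite cab; apply: normal_closure_id.
(* Likewise b now stands for b * w, whose closure lies in that of a. *)
rewrite -(proj_mulr nN b Nw) in cab *; move: (b * w) caw cab => {w Nw}b cba cab.
have [|u Nu cbu] := @normal_closure_lift _ _ nN b a.
  by rewrite -cab; apply: normal_closure_id.
move/normal_closure_sub in cba; move/normal_closure_sub in cbu.
have cE : normal_closure a = normal_closure b.
  apply/seteqP; split=> //.
  by rewrite -(minz u Nu (subset_trans cbu cba)).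
case: (mG _ _ cE) => [|] /(proj_conjugate nN); first by left.
by rewrite projV; right.
Qed.
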